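(* Consider the quantized estimation system described in the context. Assume (i) the interior of $\Theta$ in $\mathbb{R}^{D_\theta}$ is nonempty, and (ii) for every $j$ and every $\mathbf{s}\in\mathcal{S}_j$, $q_j^{(\mathbf{s})}(\theta)$ is continuous in $\theta$. Then for any quantization regions $\{I_{jl}^{(r)}\}$ and any statistical models $\{(\mathscr{X}_j,\mathscr{F}_j,\mathscr{P}_j^\theta)\}$, if $$D_\theta>\lambda(N,\{R_{jl}\}):=\sum_{j=1}^N\prod_{l=1}^{L_j}R_{jl}-N,$$ then the parameter space $\Theta$ is not identifiable. Moreover, for any subset $\mathcal{U}\subset\Theta$ that is open in $\mathbb{R}^{D_\theta}$, there are infinitely many parameter points in $\mathcal{U}$ which are not identifiable.
   Context: Setting: $\Theta\subset\mathbb{R}^{D_\theta}$ is a parameter set. There are $N\ge 1$ sensors. Sensor $j$ observes a random vector $\mathbf{x}_j$ with statistical model $(\mathscr{X}_j,\mathscr{F}_j,\mathscr{P}_j^\theta)$ (law $\mathscr{P}_j^\theta$ on the measurable space $(\mathscr{X}_j,\mathscr{F}_j)$, indexed by $\theta\in\Theta$); $\mathbf{x}_1,\dots,\mathbf{x}_N$ are independent. Each $\mathbf{x}_j$ is partitioned into $L_j\ge1$ disjoint subvectors $\mathbf{x}_j=[\mathbf{x}_{j1}^T,\dots,\mathbf{x}_{jL_j}^T]^T$. For each $j,l$, $\gamma_{jl}$ is an $R_{jl}$-level vector quantizer: disjoint regions $I_{jl}^{(1)},\dots,I_{jl}^{(R_{jl})}$ cover its domain and $\gamma_{jl}(\mathbf{x}_{jl})=r$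 iff $\mathbf{x}_{jl}\in I_{jl}^{(r)}$. The (measurable) superquantizer is $\Gamma_j(\mathbf{x}_j)=[\gamma_{j1}(\mathbf{x}_{j1}),\dots,\gamma_{jL_j}(\mathbf{x}_{jL_j})]^T$; the fusion center receives $\mathbf{u}=[\mathbf{u}_1^T,\dots,\mathbf{u}_N^T]^T$, $\mathbf{u}_j=\Gamma_j(\mathbf{x}_j)$. $\mathcal{S}_j$ is the set of all possible outcomes of $\Gamma_j$, $q_j^{(\mathbf{s})}(\theta)=\mathscr{P}_j^\theta(\Gamma_j(\mathbf{x}_j)=\mathbf{s})$, and $\Pr(\mathbf{u}\mid\theta)=\prod_{j=1}^N q_j^{(\mathbf{u}_j)}(\theta)$. Two distinct $\theta,\theta'\in\Theta$ are observationally equivalent if $\Pr(\mathbf{u}\mid\theta)=\Pr(\mathbf{u}\mid\theta')$ for all possible $\mathbf{u}$. A point $\theta$ is identifiable if no $\theta'\in\Theta\setminus\{\theta\}$ is observationally equivalent to it; $\Theta$ is identifiable if every point of $\Theta$ is identifiable. *)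

(* Defs.v *)
From HB Require Import structures.
From mathcomp Require Import all_boot all_order all_algebra.
From mathcomp Require Import all_classical all_reals all_analysis.
Set Implicit Arguments. Unset Strict Implicit. Unset Printing Implicit Defensive.
Import Order.TTheory GRing.Theory Num.Theory.
Import numFieldNormedType.Exports.
Local Open Scope classical_set_scope.
Local Open Scope ring_scope.

(* Superquantizer of one sensor: the sensor observation x lives in T; its
   l-th subvector is [sub l x] (in Y l); the l-th quantizer [g l] maps a
   subvector to its level in 'I_(R l) (level r+1 of the paper is r here);
   the region I^(r) is the preimage of r under [g l].  The output is the
   vector of levels, encoded as a function 'I_L -> nat. *)
Definition superquant (T : Type) (L : nat) (Rl : 'I_L -> nat) (Y : 'I_L -> Type)
  (sub : forall l, T -> Y l) (g : forall l, Y l -> 'I_(Rl l)) (x : T)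
  : 'I_L -> nat := fun l => nat_of_ord (g l (sub l x)).

Definition qprob (R : realType) (V : Type) (d : measure_display)
  (T : measurableType d) (O : Type) (P : V -> probability T R) (G : T -> O)
  (s : O) (theta : V) : R :=
  fine (P theta (G @^-1` [set s])).

Definition PrU (R : realType) (V : Type) (N : nat) (O : 'I_N -> Type)
  (q : forall j, O j -> V -> R) (u : forall j, O j) (theta : V) : R :=
  \prod_(j < N) q j (u j) theta.

(* theta, theta' distinct and observationally equivalent; S j = set of
   possible outcomes of sensor j *)
Definition obs_equiv (R : realType) (V : Type) (N : nat) (O : 'I_N -> Type)
  (S : forall j, set (O j)) (q : forall j, O j -> V -> R) (theta theta' : V) :=
  theta <> theta' /\
  forall u : (forall j, O j), (forall j, S j (u j)) ->
    PrU q u theta = PrU q u theta'.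

Definition identifiable_pt (R : realType) (V : Type) (N : nat) (O : 'I_N -> Type)
  (S : forall j, set (O j)) (q : forall j, O j -> V -> R) (Theta : set V)
  (theta : V) :=
  ~ exists theta', Theta theta' /\ obs_equiv S q theta theta'.

Definition identifiable_set (R : realType) (V : Type) (N : nat) (O : 'I_N -> Type)
  (S : forall j, set (O j)) (q : forall j, O j -> V -> R) (Theta : set V) :=
  forall theta, Theta theta -> identifiable_pt S q Theta theta.

(* Main.v *)
Require Import Defs.
From HB Require Import structures.
From mathcomp Require Import all_boot all_order all_algebra fingroup perm.
From mathcomp Require Import zify ring lra.
From mathcomp Require Import all_classical all_reals all_analysis.
Set Implicit Arguments. Unset Strict Implicit. Unset Printing Implicit Defensive.
Import Order.TTheory GRing.Theory Num.Theory.
Import numFieldNormedType.Exports.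
Local Open Scope classical_set_scope.
Local Open Scope ring_scope.

(* The law of the quantized data depends on theta only through
   sum_j (prod_l R_jl - 1) < D_theta continuous functions, since for each
   sensor one outcome probability is determined by the others.  So it suffices
   that M < n continuous real functions cannot separate the points of a
   nonempty open U in R^n.

   Suppose f : U -> R^M is injective and take a small cube in U.  Colour a point
   by some c in Z/(M+1) that differs from all the residues mod M+1 of the
   rounded-down coordinates of f/w; the rounded coordinates then lie in a cell
   bounded by the translates of (M+1)Z by c, and nearby points of equal colour
   lie in the same cell.  By compactness, for small w no cell meets two opposite
   faces of the cube.  Labelling a point of a fine grid by the first i such that
   its cell meets the face x_i = 0 (by n if there is none) gives the boundary
   conditions of Kuhn's cubical Sperner lemma, hence n+1 adjacent points with
   different labels; but two of them share one of the M+1 <= n colours, hence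
   their cell, hence their label. *)

(** * Kuhn's cubical form of Sperner's lemma *)

(* Over the field [bool] = F_2 this is the parity of the number of bijections
   [s] with [a i = s i]; as a determinant it satisfies [rainbow_facets], the
   identity that makes the counting of labelled simplices telescope. *)
Definition rainbow n (a : 'I_n -> nat) : bool :=
  \det (\matrix_(i < n, c < n) (a i == c :> nat) : 'M[bool]_n).

Lemma rainbow_onto n (a : 'I_n -> nat) (c : 'I_n) :
  rainbow a -> exists i, a i = c.
Proof.
apply: contraPP => /forallNP ac; rewrite /rainbow.
rewrite (expand_det_col _ c) big1 // => i _; rewrite mxE.
by case: eqP => [/ac//|_]; rewrite mul0r.
Qed.

Lemma rainbow_facets n (a : 'I_n.+1 -> nat) : (forall i, (a i <= n)%N) ->
  rainbow a = \sum_(j < n.+1) rainbow (a \o lift j).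
Proof.
move=> an.
(* Multiplying by [E] replaces the last column by the sum of all of them, which
   is constantly 1; then expand along it. *)
pose M : 'M[bool]_n.+1 := \matrix_(i, c) (a i == c :> nat).
pose E : 'M[bool]_n.+1 := \matrix_(c, d) ((c == d) || (d == ord_max)).
have detE : \det E = 1.
  rewrite -det_tr det_trig; first by rewrite big1 // => i _; rewrite !mxE eqxx.
  apply/is_trig_mxP => i j ij; rewrite !mxE.
  apply/negbTE; rewrite negb_or -!val_eqE /=.
  by have := ltn_ord j; move: ij; lia.
have -> : rainbow a = \det (M *m E) by rewrite det_mulmx detE mulr1.
have ME i d : (M *m E) i d = (a i == d :> nat) || (d == ord_max).
  rewrite mxE (bigD1 (Ordinal (an i : (a i < n.+1)%N))) //= !mxE eqxx mul1r.
  rewrite big1 ?addr0 -?val_eqE //= => c; rewrite -val_eqE /= !mxE eq_sym.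
  by move=> /negbTE ->; rewrite mul0r.
rewrite (expand_det_col _ ord_max); apply: eq_bigr => i _.
rewrite ME eqxx orbT mul1r /cofactor.
have -> : (-1) ^+ (i + @ord_max n) = 1 :> bool by exact: expr1n.
rewrite mul1r; congr (\det _); apply/matrixP => r c; rewrite [RHS]mxE [LHS]mxE [LHS]mxE ME.
by rewrite [_ == ord_max]eq_sym (negbTE (neq_lift _ _)) orbF lift_max.
Qed.

(** Right multiplication by [t] matches even permutations with odd ones of equal value, so the sum
    cancels modulo 2. *)
Lemma sum_odd_perm n (t : 'S_n) (F : 'S_n -> bool) : odd_perm t ->
  (forall s, F (s * t)%g = F s) -> \sum_s F s = 0.
Proof.
move=> ot Ft; rewrite (bigID (@odd_perm _)) /= (reindex_inj (mulIg t)) /=.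
under eq_bigl do rewrite odd_permM ot addbT.
under eq_bigr do rewrite Ft.
exact: addbb.
Qed.

(** Permutations are sorted by the preimage [i] of [p]; when [p] is the first or last time, [i] is
    the coordinate moved then. *)
Lemma sum_lift_perm n (p : 'I_n.+1) (F : 'S_n.+1 -> bool) :
  \sum_s F s = \sum_i \sum_(t : 'S_n) F (lift_perm i p t).
Proof.
rewrite pair_bigA /= (reindex (fun it => lift_perm it.1 p it.2)) //=.
apply: onW_bij; apply: inj_card_bij; last first.
  by rewrite card_prod !card_Sn card_ord factS.
move=> [i t] [j u] /= E.
have ij : i = j.
  by apply: (@perm_inj _ (lift_perm i p t)); rewrite {2}E !lift_perm_id.
subst j; congr (_, _); apply/permP => k; apply: (@lift_inj _ p).
by rewrite -!(lift_perm_lift i) E.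
Qed.

Definition insert n (i : 'I_n.+1) (t : nat) (y : 'I_n -> nat) (j : 'I_n.+1) :=
  if unlift i j is Some j' then y j' else t.

Lemma sum_insert n k (i : 'I_n.+1) (F : ('I_n.+1 -> nat) -> bool) :
  \sum_(x : {ffun 'I_n.+1 -> 'I_k}) F (fun j => x j) =
  \sum_(y : {ffun 'I_n -> 'I_k}) \sum_(t < k) F (insert i t (fun j => y j)).
Proof.
rewrite pair_bigA /=.
pose h (yt : {ffun 'I_n -> 'I_k} * 'I_k) : {ffun 'I_n.+1 -> 'I_k} :=
  [ffun j => if unlift i j is Some j' then yt.1 j' else yt.2].
rewrite (reindex h) /=; last first.
  apply: onW_bij;
    exists (fun x : {ffun 'I_n.+1 -> 'I_k} => ([ffun j : 'I_n => x (lift i j)], x i)).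
    move=> [y t]; congr (_, _); rewrite ?ffunE /= ?unlift_none //.
    by apply/ffunP => j; rewrite !ffunE liftK.
  by move=> x; apply/ffunP => j; rewrite ffunE; case: unliftP => [j'|] -> //=; rewrite ffunE.
apply: eq_bigr => -[y t] _; congr F; apply/funext => j.
by rewrite ffunE /insert; case: unliftP.
Qed.

Lemma sum_telescope k (g : nat -> bool) :
  \sum_(t < k) g t.+1 + \sum_(t < k) g t = g k + g 0%N.
Proof.
elim: k => [|k IH]; first by rewrite !big_ord0; case: (g 0%N).
rewrite !big_ord_recr /= addrACA IH.
by case: (g k); case: (g 0%N); case: (g k.+1).
Qed.

(* The simplices of Kuhn's triangulation: starting from [x], coordinate [j] is
   incremented at time [s j]; [m] is the number of steps made. *)
Definition kuhn_vertex n (x : 'I_n -> nat) (s : 'S_n) (m : nat) : 'I_n -> nat :=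
  fun j => (x j + (s j < m))%N.

Definition kuhn_sum n k (l : ('I_n -> nat) -> nat) : bool :=
  \sum_(x : {ffun 'I_n -> 'I_k}) \sum_(s : 'S_n)
     rainbow (fun m : 'I_n.+1 => l (kuhn_vertex (fun j => x j) s m)).

(** Induction on [n]: modulo 2 the count reduces to that on the face where the last coordinate is 0,
    whose labelling satisfies the same hypotheses. *)
Lemma kuhn_sum1 n k (l : ('I_n -> nat) -> nat) : (0 < k)%N ->
  (forall x, (forall i, x i <= k)%N -> (l x <= n)%N) ->
  (forall x i, (forall i, x i <= k)%N -> x i = 0%N -> (l x <= i)%N) ->
  (forall x i, (forall i, x i <= k)%N -> x i = k -> l x <> i) ->
  kuhn_sum k l.
Proof.
elim: n => [|n IH] in l * => k0 ln l0 lk.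
  rewrite /kuhn_sum (big_pred1 [ffun i : 'I_0 => Ordinal k0]); last first.
    by move=> x; apply/esym/eqP/ffunP => -[].
  rewrite (big_pred1 1%g); last by move=> s; apply/esym/eqP/permP => -[].
  rewrite /rainbow det_mx11 mxE /=.
  by rewrite -leqn0; apply: ln => -[].
have vk (x : {ffun 'I_n.+1 -> 'I_k}) s m j :
    (kuhn_vertex (fun j => x j) s m j <= k)%N.
  by rewrite /kuhn_vertex; have := ltn_ord (x j); case: (_ < m)%N => /=; lia.
pose h x s m := l (kuhn_vertex (fun j : 'I_n.+1 => x j) s m).
have -> : kuhn_sum k l = \sum_(x : {ffun 'I_n.+1 -> 'I_k})
    (\sum_s rainbow (fun m : 'I_n.+1 => h (fun j => x j) s m.+1)
     + \sum_s rainbow (fun m : 'I_n.+1 => h (fun j => x j) s m)).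
  apply: eq_bigr => x _.
  under eq_bigr do
    (rewrite rainbow_facets; last by move=> m; apply: ln => j; apply: vk).
  rewrite exchange_big big_ord_recl big_ord_recr /= [X in _ + (X + _)]big1 ?add0r.
    congr (_ + _); apply: eq_bigr => s _; congr (rainbow _);
      apply/funext => m /=; rewrite /h; congr (l (kuhn_vertex _ _ _)).
    by rewrite /bump; have := ltn_ord m; lia.
  (* An interior facet does not see the order of steps [j] and [j + 1]. *)
  move=> j _; pose a : 'I_n.+1 := widen_ord (leqnSn n) j.
  pose b : 'I_n.+1 := lift ord0 j.
  apply: (@sum_odd_perm _ (tperm a b)).
    by rewrite odd_tperm -val_eqE /=; apply/eqP; rewrite /bump; lia.
  move=> s; congr (rainbow _); apply/funext => m /=; congr l.
  apply/funext => i; rewrite /kuhn_vertex permM; congr (_ + _)%N.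
  by case: tpermP => [->|->|//]; rewrite /= /bump; lia.
(* The facet opposite the first vertex and the one opposite the last vertex are
   translates of each other: parametrized by the coordinate [i] moved at the
   omitted step, they telescope along [i] to the two faces of the box. *)
rewrite big_split /=.
under eq_bigr do rewrite (sum_lift_perm ord0).
rewrite exchange_big /=.
under [X in _ + X]eq_bigr do rewrite (sum_lift_perm ord_max).
rewrite [X in _ + X]exchange_big /= -big_split /=.
pose G i (t : 'S_n) (y : 'I_n -> nat) r :=
  rainbow (fun m : 'I_n.+1 => l (insert i r (kuhn_vertex y t m))).
have E i : \sum_(x : {ffun 'I_n.+1 -> 'I_k}) \sum_t
     rainbow (fun m : 'I_n.+1 => h (fun j => x j) (lift_perm i ord0 t) m.+1)
   + \sum_(x : {ffun 'I_n.+1 -> 'I_k}) \sum_t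
     rainbow (fun m : 'I_n.+1 => h (fun j => x j) (lift_perm i ord_max t) m)
   = \sum_(y : {ffun 'I_n -> 'I_k}) \sum_t
       (G i t (fun j => y j) k + G i t (fun j => y j) 0%N).
  rewrite (sum_insert k i (fun x => \sum_t
     rainbow (fun m : 'I_n.+1 => h x (lift_perm i ord0 t) m.+1))).
  rewrite (sum_insert k i (fun x => \sum_t
     rainbow (fun m : 'I_n.+1 => h x (lift_perm i ord_max t) m))).
  rewrite -big_split; apply: eq_bigr => y _ /=.
  rewrite exchange_big [X in _ + X]exchange_big -big_split.
  apply: eq_bigr => t _ /=; rewrite -sum_telescope.
  congr (_ + _); apply: eq_bigr => r _; congr (rainbow _);
    apply/funext => m; congr l; apply/funext => j;
    rewrite /kuhn_vertex /insert; case: (unliftP i j) => [j'|] -> /=;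
    rewrite ?lift_perm_lift ?lift_perm_id //= ?addn1 //.
    by rewrite /bump (leqNgt n) ltn_ord.
  by rewrite ltnNge -ltnS ltn_ord addn0.
rewrite (eq_bigr _ (fun i _ => E i)).
have bk i r t (y : {ffun 'I_n -> 'I_k}) m j : (r <= k)%N ->
    (insert i r (kuhn_vertex (fun j => y j) t m) j <= k)%N.
  move=> rk; rewrite /insert /kuhn_vertex; case: unliftP => // j' _.
  by have := ltn_ord (y j'); case: (_ < m)%N => /=; lia.
(* The face at height [k] along [i] lacks the label [i]; the face at height 0 has labels at most
   [i], hence lacks the label [n] unless [i] is last. *)
have Gk i t (y : {ffun 'I_n -> 'I_k}) : G i t (fun j => y j) k = false.
  apply/negP => /(rainbow_onto i) [m]; apply: lk => [j|].
    exact: bk.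
  by rewrite /insert unlift_none.
have Gi i t (y : {ffun 'I_n -> 'I_k}) : i != ord_max ->
    G i t (fun j => y j) 0%N = false.
  move=> im; apply/negP => /(rainbow_onto ord_max) [m] E'.
  have : (n <= i)%N.
    rewrite -[X in (X <= _)%N]E'; apply: l0 => [j|]; first exact: bk.
    by rewrite /insert unlift_none.
  by move: im; rewrite -val_eqE /=; have := ltn_ord i; lia.
rewrite (bigD1 ord_max) //= [X in _ + X]big1 ?addr0; last first.
  move=> i im; rewrite big1 // => y _; rewrite big1 // => t _.
  by rewrite Gk Gi.
under eq_bigr do under eq_bigr do rewrite Gk add0r.
pose l' x := l (insert ord_max 0%N x).
have bx x j : (forall i, x i <= k)%N -> (@insert n ord_max 0%N x j <= k)%N.
  by move=> xk; rewrite /insert; case: unliftP.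
apply: (IH l') => // [x xk|x i xk xi|x i xk xi].
- by apply: (l0 _ ord_max) => [j|]; rewrite ?bx // /insert unlift_none.
- have -> : (i : nat) = lift ord_max i by rewrite lift_max.
  by apply: l0 => [j|]; rewrite ?bx // /insert liftK.
- have -> : (i : nat) = lift ord_max i by rewrite lift_max.
  by apply: lk => [j|]; rewrite ?bx // /insert liftK.
Qed.

Lemma kuhn n k (l : ('I_n -> nat) -> nat) : (0 < k)%N ->
  (forall x, (forall i, x i <= k)%N -> (l x <= n)%N) ->
  (forall x i, (forall i, x i <= k)%N -> x i = 0%N -> (l x <= i)%N) ->
  (forall x i, (forall i, x i <= k)%N -> x i = k -> l x <> i) ->
  exists x, forall c : 'I_n.+1, exists2 y,
    forall i, (x i <= y i <= (x i).+1)%N && (y i <= k)%N & l y = c.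
Proof.
move=> k0 ln l0 lk; have := kuhn_sum1 k0 ln l0 lk.
apply: contraPP => /forallNP nx; rewrite /kuhn_sum big1 // => x _.
rewrite big1 // => s _; apply: negbTE; apply/negP => /rainbow_onto full.
apply: (nx (fun j => x j)).
move=> c; have [m lm] := full c; eexists; last exact: lm.
by move=> i; rewrite /kuhn_vertex; have := ltn_ord (x i); case: (_ < m)%N => /=; lia.
Qed.

(** * Maps with too few components cannot separate opposite faces *)

(** Between consecutive integers the quotient changes only on reaching a number congruent to [c],
    and neither [r] nor [r'] is one. *)
Lemma divz_adjacent (M : nat) (c r r' : int) :
  `|r - r'| <= 1 -> (r %% M.+1)%Z != (c %% M.+1)%Z ->
  (r' %% M.+1)%Z != (c %% M.+1)%Z -> ((r - c) %/ M.+1)%Z = ((r' - c) %/ M.+1)%Z.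
Proof.
move=> rr; rewrite !eqz_mod_dvd => h h'.
wlog: r r' rr h h' / (r <= r').
  move=> W; case: (leP r r') => [/W|/ltW/W W']; first exact.
  by symmetry; apply: W' => //; rewrite distrC.
move=> le; have [->//|r'E] : r' = r \/ r' = r + 1 by lia.
rewrite r'E in h' *.
have := divz_eq (r - c) M.+1; set q := ((r - c) %/ _)%Z; set t := ((r - c) %% _)%Z => e.
have t0 : 0 <= t by exact: modz_ge0.
have tM : t < M.+1%:Z by rewrite ltz_pmod.
have : t + 1 != M.+1%:Z.
  apply: contra h' => /eqP tE; apply/dvdzP; exists (q + 1).
  by rewrite mulrDl mul1r -tE; lia.
move=> tN.
have -> : r + 1 - c = q * M.+1%:Z + (t + 1) by lia.
rewrite divzMDl // divz_small ?addr0 //; lia.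
Qed.

Lemma eq_divz_dist (M : nat) (c r r' : int) :
  ((r - c) %/ M.+1)%Z = ((r' - c) %/ M.+1)%Z -> `|r - r'| <= M%:Z.
Proof.
move=> e; have := divz_eq (r - c) M.+1; have := divz_eq (r' - c) M.+1.
rewrite e.
have := modz_ge0 (r - c) (isT : M.+1%:Z != 0).
have := modz_ge0 (r' - c) (isT : M.+1%:Z != 0).
have := ltz_pmod (r - c) (isT : 0 < M.+1%:Z).
have := ltz_pmod (r' - c) (isT : 0 < M.+1%:Z).
by set X := (_ %% _)%Z; set Y := (_ %% _)%Z; lia.
Qed.

Lemma avoid_residues (I : finType) (r : I -> int) :
  exists c : 'I_(#|I|.+1), forall l, (r l %% #|I|.+1)%Z != (c %% #|I|.+1)%Z.
Proof.
pose f l : 'I_(#|I|.+1) := inord `|(r l %% #|I|.+1)%Z|%N.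
have [c cf] : exists c, c \notin codom f.
  apply/existsP; rewrite -negb_forall; apply/negP => /forallP cf.
  suff : (#|'I_(#|I|.+1)| <= #|I|)%N by rewrite card_ord ltnn.
  by apply: leq_trans (leq_image_card f _); apply/subset_leq_card/fintype.subsetP => c _.
exists c => l; apply: contra cf => /eqP e; apply/codomP; exists l.
by apply: val_inj; rewrite /f e modz_small ?ltz_nat //= ?absz_nat ?inordK.
Qed.

(** Discrete form of the argument, with [r] the rounded values at grid points; the bound [#|I|]
    comes from cells of width [#|I|.+1]. *)
Lemma coarse_coincidence n k (I : finType) (r : ('I_n -> nat) -> I -> int) :
  (0 < k)%N -> (#|I| < n)%N ->
  (forall x y l, (forall i, (x i <= k)%N && (y i <= k)%N) ->
     (forall i, (x i <= (y i).+1)%N && (y i <= (x i).+1)%N) ->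
     `|r x l - r y l| <= 1) ->
  exists i x y, [/\ forall i, (x i <= k)%N && (y i <= k)%N, x i = 0%N, y i = k &
     forall l, `|r x l - r y l| <= #|I|%:Z].
Proof.
move=> k0 In rl; apply: contrapT => no.
have /choice [col colE] x := avoid_residues (r x).
pose cell x := (col x, [ffun l => ((r x l - (col x : nat)%:Z) %/ #|I|.+1)%Z]).
pose meets x (i : 'I_n) :=
    `[< exists y, [/\ forall j, (y j <= k)%N, y i = 0%N & cell y = cell x] >].
(* [find] returns the length [n] when the cell meets none of the faces. *)
pose lab x := find (meets x) (enum 'I_n).
have nth_meets x (i : 'I_n) : lab x = i -> meets x i.
  move=> e; have : has (meets x) (enum 'I_n) by rewrite has_find -/(lab x) e size_enum_ord.
  by move=> /(nth_find i); rewrite -/(lab x) e nth_ord_enum.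
have lab_cell x y : cell x = cell y -> lab x = lab y.
  by move=> e; apply: eq_find => i; rewrite /meets e.
have cell_dist x y l : cell x = cell y -> `|r x l - r y l| <= #|I|%:Z.
  move=> [cxy /ffunP/(_ l)]; rewrite !ffunE cxy; exact: eq_divz_dist.
have [//|x xk|x i xk xi|x i xk xi|x full] := @kuhn n k lab.
- by rewrite -[X in (_ <= X)%N](size_enum_ord n) find_size.
- rewrite leqNgt; apply/negP => /(before_find i); rewrite nth_ord_enum.
  by move/negP; apply; apply/asboolP; exists x.
- move=> /nth_meets/asboolP[y [yk y0 yx]]; apply: no; exists i, y, x; split => //.
    by move=> j; rewrite xk yk.
  by move=> l; apply: cell_dist.
have /choice [Y YE] : forall c : 'I_n.+1, exists y,
    (forall i, (x i <= y i <= (x i).+1)%N && (y i <= k)%N) /\ lab y = c :> nat.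
  by move=> c; have [y ? ?] := full c; exists y.
have /injectivePn [c [c' cc' colcc']] : ~~ injectiveb (col \o Y).
  apply/negP => /injectiveP/leq_card; rewrite !card_ord ltnS leqNgt.
  by rewrite In.
suff : cell (Y c) = cell (Y c').
  by move/lab_cell; rewrite !(YE _).2 => /val_inj e; rewrite e eqxx in cc'.
have {}colcc' : col (Y c) = col (Y c') := colcc'.
rewrite /cell -colcc'; congr (_, _); apply/ffunP => l; rewrite !ffunE.
apply: divz_adjacent.
- apply: rl => i; have /andP[/andP[? ?] ?] := (YE c).1 i;
  by have /andP[/andP[? ?] ?] := (YE c').1 i; lia.
- exact: colE.
- by rewrite colcc'; apply: colE.
Qed.

(** * Continuous maps into a space of smaller dimension *)

Lemma continuous_at_sum (T : topologicalType) (R : realType) (I : Type)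
  (r : seq I) (g : I -> T -> R) (p : T) :
  (forall l, {for p, continuous (g l)}) ->
  {for p, continuous (fun q => \sum_(l <- r) g l q)}.
Proof.
move=> cg; elim: r => [|l r IH].
  under [X in {for p, continuous X}]funext do rewrite big_nil.
  exact: cvg_cst.
under [X in {for p, continuous X}]funext do rewrite big_cons.
exact: (cvgD (cg l) IH).
Qed.

(** Near a point with [g p > 0] the premise fails for [e < g p / 2]; near any other point the
    conclusion persists by continuity. Compactness makes [e] uniform. *)
Lemma compact_small_imply (T : topologicalType) (R : realType) (K : set T)
  (g h : T -> R) (w : R) : compact K ->
  (forall p, K p -> {for p, continuous g}) ->
  (forall p, K p -> {for p, continuous h}) ->
  (forall p, K p -> g p <= 0 -> h p < w) ->
  exists2 e, 0 < e & forall p, K p -> g p < e -> h p < w.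
Proof.
move=> cK cg ch gh.
have nK := (compact_near_coveringP K).1 cK _ (0 : R)^'+
  (fun e p => g p < e -> h p < w) _.
have : \forall e \near (0 : R)^'+, K `<=` (fun p => g p < e -> h p < w).
  apply: nK => p Kp.
  have [gp|gp] := leP (g p) 0.
    have hp := gh p Kp gp.
    have := cvgr_lt _ (ch p Kp) _ hp => nh.
    exists ([set q | h q < w], setT); first by split; [exact: nh | exact: filterT].
    by move=> [q e] [/= hq _].
  have gp2 : g p / 2 < g p by lra.
  have ng := cvgr_gt _ (cg p Kp) _ gp2.
  exists ([set q | g p / 2 < g q], [set e | e < g p / 2]); first split.
  - exact: ng.
  - by apply: nbhs_right_lt; lra.
  - by move=> [q e] [/= hq he] /=; lra.
move=> ne.
near (0 : R)^'+ => e; exists e => //.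
exact: (near ne e).
Unshelve. all: by end_near. Qed.

Lemma norm_coord_le (R : realType) n (v : 'rV[R]_n) i : `|v 0 i| <= `|v|.
Proof.
rewrite [leRHS]/Num.norm /= mx_normrE; apply/bigmax_geP; right => /=.
by exists (0, i).
Qed.

Lemma norm_lt_coord (R : realType) n (v : 'rV[R]_n) e : 0 < e ->
  (forall i, `|v 0 i| < e) -> `|v| < e.
Proof.
move=> e0 ve; rewrite [ltLHS]/Num.norm /= mx_normrE; apply/bigmax_ltP; split => //=.
by case=> i j _ /=; rewrite ord1.
Qed.

Lemma floor_adjacent (R : realType) (x y : R) : `|x - y| < 1 ->
  `|Num.floor x - Num.floor y| <= 1.
Proof.
rewrite ltr_norml => /andP[xy1 xy2].
have /andP[] := floor_itv x; have /andP[] := floor_itv y.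
set a := Num.floor x; set b := Num.floor y; rewrite !intrD => h1 h2 h3 h4.
have : a%:~R < (b + 2)%:~R :> R by rewrite intrD; lra.
have : b%:~R < (a + 2)%:~R :> R by rewrite intrD; lra.
by rewrite !ltr_int; lia.
Qed.

Lemma dist_floor (R : realType) (x y : R) (m : nat) :
  `|Num.floor x - Num.floor y| <= m%:Z -> `|x - y| < m.+1%:R.
Proof.
have /andP[] := floor_itv x; have /andP[] := floor_itv y.
set a := Num.floor x; set b := Num.floor y; rewrite !intrD => h1 h2 h3 h4 ab.
have : a%:~R <= (b + m%:Z)%:~R :> R by rewrite ler_int; lia.
have : b%:~R <= (a + m%:Z)%:~R :> R by rewrite ler_int; lia.
by rewrite !intrD -natr1 -!pmulrn ltr_norml => ? ?; apply/andP; split; lra.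
Qed.

Lemma open_coincidence (R : realType) n (I : finType) (f : I -> 'rV[R]_n -> R)
  (U : set 'rV[R]_n) : (#|I| < n)%N -> open U -> U !=set0 ->
  (forall l x, U x -> {for x, continuous (f l)}) ->
  exists x y, [/\ U x, U y, x <> y & forall l, f l x = f l y].
Proof.
move=> In oU [a Ua] cf; apply: contrapT => no.
have /nbhs_ballP[e /= e0 eU] : nbhs a U by exact: open_nbhs_nbhs.
pose s := e / 2; have s0 : 0 < s by rewrite divr_gt0.
pose K := [set v : 'rV[R]_n | forall i, `[a 0 i, a 0 i + s]%classic (v 0 i)].
have cK : compact K.
  exact: (rV_compact (fun i => @segment_compact _ (a 0 i) (a 0 i + s))).
have KU : K `<=` U.
  move=> v Kv; apply: eU; rewrite mx_norm_ball /ball_ /=.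
  apply: norm_lt_coord => // i; have := Kv i; rewrite /= in_itv /= !mxE.
  by rewrite /s ltr_norml => /andP[? ?]; apply/andP; split; lra.
(* [G] compares values and [H] compares points. On pairs from [K], small [G] forces small [H] by the
   assumed injectivity, and small [H] forces small [G] by continuity. *)
pose G (p : 'rV[R]_n * 'rV[R]_n) := \sum_l `|f l p.1 - f l p.2|.
pose H (p : 'rV[R]_n * 'rV[R]_n) := `|p.1 - p.2|.
have cH p : {for p, continuous H}.
  apply: cvg_norm; apply: cvgB; [exact: cvg_fst|exact: cvg_snd].
have cG p : (K `*` K) p -> {for p, continuous G}.
  move=> [K1 K2]; apply: continuous_at_sum => l; apply: cvg_norm; apply: cvgB.
    by apply: continuous_comp; [exact: cvg_fst|exact/cf/KU].
  by apply: continuous_comp; [exact: cvg_snd|exact/cf/KU].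
have cKK := compact_setX cK cK.
have [eps eps0 Heps] : exists2 d, 0 < d & forall p, (K `*` K) p -> G p < d -> H p < s.
  apply: compact_small_imply => // -[x y] [/= Kx Ky] Gxy.
  suff -> : x = y by rewrite /H subrr normr0.
  apply: contrapT => xy; apply: no; exists x, y; split => //; try exact: KU.
  move=> l; apply/eqP; rewrite -subr_eq0 -normr_le0; apply: le_trans Gxy.
  by rewrite /G (bigD1 l) //= lerDl sumr_ge0.
pose M := #|I|.
(* The coincidence will bound each of the [M] differences by [(M + 1) * w], hence [G] by
   [M / (M + 1) * eps < eps]. *)
pose w := eps / M.+1%:R ^+ 2.
have w0 : 0 < w by rewrite divr_gt0 // exprn_gt0.
have [d d0 Hd] : exists2 d, 0 < d & forall p, (K `*` K) p -> H p < d -> G p < w.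
  apply: compact_small_imply => // -[x y] _; rewrite /H normr_le0 subr_eq0 /=.
  by move=> /eqP ->; rewrite /G big1 // => l _; rewrite subrr normr0.
(* This makes the mesh [s / k] smaller than [d]. *)
pose k := Num.bound (s / d).
have sk : s / d < k%:R by apply: le_lt_trans (archi_boundP _) => //; rewrite divr_ge0 ?ltW.
have k0 : 0 < k%:R :> R by apply: lt_trans sk; rewrite divr_gt0.
pose pt (x : 'I_n -> nat) : 'rV[R]_n := \row_j (a 0 j + s * ((x j)%:R / k%:R)).
have Kpt x : (forall i, x i <= k)%N -> K (pt x).
  move=> xk i; rewrite /= in_itv /= mxE lerDl lerD2l ger_pMr //.
  by rewrite ler_pdivrMr // mul1r ler_nat xk andbT mulr_ge0 ?divr_ge0 // ltW.
pose r x l := Num.floor (f l (pt x) / w).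
have [||x y l xyk xy|i [x [y [xyk xi yi xy]]]] := @coarse_coincidence n k I r.
- by rewrite -(ltr_nat R).
- exact: In.
- apply: floor_adjacent.
  rewrite -mulrBl normrM normfV (gtr0_norm w0) ltr_pdivrMr // mul1r.
  apply: (@le_lt_trans _ _ (G (pt x, pt y))).
    by rewrite /G (bigD1 l) //= lerDl sumr_ge0.
  apply: Hd; first by split; apply: Kpt => i; have /andP[] := xyk i.
  apply: norm_lt_coord => // i; rewrite !mxE.
  rewrite (_ : _ - _ = s / k%:R * ((x i)%:R - (y i)%:R)); last by ring.
  rewrite normrM gtr0_norm ?divr_gt0 //.
  apply: (@le_lt_trans _ _ (s / k%:R)).
    apply: ler_piMr; first by rewrite divr_ge0 // ltW.
    rewrite ler_norml; have /andP[] := xy i.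
    by rewrite -!(ler_nat R) -!natr1 => ? ?; apply/andP; split; lra.
  by rewrite ltr_pdivrMr // mulrC -ltr_pdivrMr.
have : H (pt x, pt y) < s.
  apply: Heps; first by split; apply: Kpt => j; have /andP[] := xyk j.
  apply: (@le_lt_trans _ _ (\sum_(l : I) (M.+1%:R * w))).
    apply: ler_sum => l _; apply: ltW.
    by rewrite -ltr_pdivrMr // -(gtr0_norm w0) -normfV -normrM mulrBl; exact/dist_floor/xy.
  have -> : \sum_(l : I) (M.+1%:R * w) = (M.+1%:R * w) *+ M.
    by rewrite -sumr_const; apply: eq_bigl.
  rewrite -mulr_natl /w.
  rewrite (_ : _ * _ = M%:R / M.+1%:R * eps); last first.
    have : M.+1%:R != 0 :> R by rewrite pnatr_eq0.
    by move: (M.+1%:R) => c c0; field.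
  by rewrite gtr_pMl // ltr_pdivrMr // mul1r ltr_nat.
(* The two points lie on opposite faces, so their coordinates [i] differ by exactly [s]. *)
apply/negP; rewrite -leNgt; apply: le_trans (norm_coord_le _ i).
by rewrite !mxE xi yi mul0r mulr0 divff ?gt_eqF // mulr1 addr0 opprD addNKr normrN gtr0_norm.
Qed.

(** * Outcome probabilities of a sensor *)

Lemma card_outcomes L (Rl : 'I_L -> nat) :
  #|{dffun forall l : 'I_L, 'I_(Rl l)}| = (\prod_(l < L) Rl l)%N.
Proof.
rewrite card_dep_ffun foldrE big_image /=.
by apply: eq_bigr => l _; rewrite card_ord.
Qed.

Section Sensor.
Context (R : realType) (V : Type) (d : measure_display) (T : measurableType d).
Context (L : nat) (Rl : 'I_L -> nat) (Y : 'I_L -> Type).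
Context (sub : forall l, T -> Y l) (g : forall l, Y l -> 'I_(Rl l)).
Context (P : V -> probability T R).
Let G := superquant sub g.

Lemma superquant_outcome s : range G s ->
  exists t : {dffun forall l : 'I_L, 'I_(Rl l)}, s = (fun l => t l : nat).
Proof.
move=> [x _ <-]; exists (finfun (fun l => g (sub l x))).
by apply/funext => l; rewrite ffunE.
Qed.

Lemma qprob_impossible s theta : ~ range G s -> qprob P G s theta = 0.
Proof. by move=> /preimage10 Gs; rewrite /qprob Gs measure0. Qed.

Hypothesis mG : forall s, measurable (G @^-1` [set s]).

(** The fibres of [G] over all tuples of levels partition the sample space; impossible tuples have
    empty fibres. *)
Lemma sum_qprob theta :
  \sum_(t : {dffun forall l : 'I_L, 'I_(Rl l)})
    qprob P G (fun l => t l : nat) theta = 1.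
Proof.
pose F (t : {dffun forall l : 'I_L, 'I_(Rl l)}) := G @^-1` [set (fun l => t l : nat)].
have cover : \bigcup_(t in [set` enum {dffun forall l : 'I_L, 'I_(Rl l)}]) F t = setT.
  apply/seteqP; split => // x _.
  have [t Gx] := superquant_outcome (imageT G x).
  by exists t; rewrite /= ?mem_enum.
apply/EFin_inj; rewrite -(probability_setT (P theta)) -cover.
rewrite measure_fin_bigcup; first last.
- by move=> t _; exact: mG.
- move=> t t' _ _ [x [/= Gt Gt']]; apply/ffunP => l; apply: val_inj.
  by have := congr1 (fun s => s l) (etrans (esym Gt) Gt').
- exact: finite_seq.
rewrite -fsbig_seq ?enum_uniq // big_enum /= -sumEFin.
by apply: eq_bigr => t _; rewrite /qprob fineK // fin_num_measure //; exact: mG.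
Qed.

Lemma qprob_eq_of_others (t0 : {dffun forall l : 'I_L, 'I_(Rl l)}) theta theta' :
  (forall t : {dffun forall l : 'I_L, 'I_(Rl l)}, t != t0 ->
     qprob P G (fun l => t l : nat) theta = qprob P G (fun l => t l : nat) theta') ->
  forall s, range G s -> qprob P G s theta = qprob P G s theta'.
Proof.
move=> eqt s /superquant_outcome[t ->].
have [->|/eqt//] := eqVneq t t0.
have := etrans (sum_qprob theta) (esym (sum_qprob theta')).
rewrite (bigD1 t0) //= [in RHS](bigD1 t0) //= (eq_bigr _ (fun t => @eqt t)).
exact: addIr.
Qed.

End Sensor.

(** * Non-identifiability of the quantized model *)

Theorem theorem2 (R : realType) (Dth : nat) (Theta : set 'rV[R]_Dth)
  (N : nat) (L : 'I_N -> nat) (Rl : forall j, 'I_(L j) -> nat)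
  (d : 'I_N -> measure_display) (X : forall j, measurableType (d j))
  (P : forall j, 'rV[R]_Dth -> probability (X j) R)
  (Y : forall j, 'I_(L j) -> Type)
  (sub : forall j l, X j -> Y j l)
  (g : forall j l, Y j l -> 'I_(Rl j l)) :
  (1 <= N)%N ->
  (forall j, 1 <= L j)%N ->
  (forall j l, 1 <= Rl j l)%N ->
  (* the superquantizers are measurable *)
  (forall j (s : 'I_(L j) -> nat),
      measurable (superquant (sub j) (g j) @^-1` [set s])) ->
  (* (i) nonempty interior *)
  Theta° !=set0 ->
  (* (ii) continuity of q_j^{(s)} on Theta, for every possible outcome s *)
  (forall j (s : 'I_(L j) -> nat), range (superquant (sub j) (g j)) s ->
      {within Theta, continuous (qprob (P j) (superquant (sub j) (g j)) s)}) ->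
  (* D_theta > sum_j prod_l R_jl - N *)
  (\sum_(j < N) \prod_(l < L j) Rl j l < Dth + N)%N ->
  ~ identifiable_set (fun j => range (superquant (sub j) (g j)))
      (fun j s => qprob (P j) (superquant (sub j) (g j)) s) Theta
  /\
  (forall U : set 'rV[R]_Dth, open U -> U `<=` Theta -> U !=set0 ->
     infinite_set [set theta | U theta /\
        ~ identifiable_pt (fun j => range (superquant (sub j) (g j)))
            (fun j s => qprob (P j) (superquant (sub j) (g j)) s) Theta theta]).
Proof.
move=> _ _ R1 mG [a Ta] cq dim.
pose T j : finType := {dffun forall l : 'I_(L j), 'I_(Rl j l)}.
pose t0 j : T j := finfun (fun l => Ordinal (R1 j l)).
(* Dropping one reference outcome [t0 j] per sensor accounts for the [N] in [dim]. *)
pose I : finType := {jt : {j : 'I_N & T j} | tagged jt != t0 (tag jt)}.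
pose G j := superquant (sub j) (g j).
pose out j (t : {dffun forall l : 'I_(L j), 'I_(Rl j l)}) l : nat := t l.
pose f (i : I) := qprob (P (tag (val i))) (G (tag (val i)))
  (@out (tag (val i)) (tagged (val i))).
have cardT j : #|T j| = (\prod_(l < L j) Rl j l)%N by exact: card_outcomes.
have cardI : (#|I| < Dth)%N.
  have -> : #|I| = (\sum_(j < N) #|T j|.-1)%N.
    rewrite card_sig -sum1_card.
    rewrite -(sig_big_dep xpredT (fun j (t : T j) => t != t0 j) (fun _ _ => 1%N)).
    by apply: eq_bigr => j _; rewrite sum1_card cardC1.
  rewrite -(ltn_add2r N); apply: leq_ltn_trans dim.
  rewrite -[X in (_ + X <= _)%N](card_ord N) -sum1_card -big_split /=.
  apply: leq_sum => j _; rewrite -cardT addn1 prednK //.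
  by apply/card_gt0P; exists (t0 j).
have cf U : open U -> U `<=` Theta ->
    forall l x, U x -> {for x, continuous (f l)}.
  move=> oU UT l x Ux; rewrite /f; set j := tag _; set s := out _ _.
  (* Continuity is assumed for possible outcomes only; the other tuples indexed by [I] have
     probability identically 0. *)
  have [rs|nrs] := pselect (range (G j) s); last first.
    have -> : qprob (P j) (G j) s = cst 0.
      by apply/funext => theta; exact: qprob_impossible.
    exact: cst_continuous.
  have := continuous_subspaceW UT (cq j s rs).
  by rewrite continuous_open_subspace // => /(_ x); rewrite inE; exact.
have pairs U : open U -> U `<=` Theta -> U !=set0 ->
    exists x y, [/\ U x, U y & obs_equiv (fun j => range (G j))
      (fun j s => qprob (P j) (G j) s) x y].
  move=> oU UT U0.
  have [x [y [Ux Uy xy fxy]]] := open_coincidence cardI oU U0 (cf U oU UT).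
  exists x, y; split => //; split => // u ru.
  apply: eq_bigr => j _; apply: (qprob_eq_of_others (mG j) (t0 := t0 j)) => // t tt0.
  exact: (fxy (Sub (Tagged T t) tt0)).
split.
  move=> ident.
  have [|x [y [Tx Ty xy]]] := pairs _ (open_interior Theta) (@interior_subset _ _).
    by exists a.
  by apply: (ident x (interior_subset Tx)); exists y; split => //; exact: interior_subset.
move=> U oU UT [u Uu].
set B := (B in infinite_set B) => finB.
have T1 : accessible_space 'rV[R]_Dth.
  exact/hausdorff_accessible/norm_hausdorff.
have fin_closed := accessible_finite_set_closed.1 T1.
have nonident x y W : W `<=` U -> W x -> W y -> obs_equiv (fun j => range (G j))
      (fun j s => qprob (P j) (G j) s) x y -> B x.
  move=> WU Wx Wy xy; split; first exact: WU.
  by move=> id; apply: id; exists y; split => //; apply/UT/WU.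
(* Finite sets are closed, so [pairs] still applies after removing one from [U]. *)
have oD A : finite_set A -> open (U `\` A).
  by move=> fA; rewrite setDE; apply: openI oU _; apply: closed_openC; exact: fin_closed fA.
have UD A : U `\` A `<=` U by move=> x [].
(* If [U] consisted of the finitely many points of [B], then [[set u]] would be
   open and contain two distinct points. *)
have [UB|nUB] := pselect (U `<=` B).
  have oW : open (U `\` (U `\ u)).
    by apply: oD; apply: sub_finite_set finB => x [/UB].
  have W1 x : (U `\` (U `\ u)) x -> x = u.
    by move=> [Ux nx]; apply: contrapT => xu; apply: nx.
  have [||x [y [/W1 -> /W1 -> []//]]] := pairs _ oW.
    by move=> x /UD /UT.
  by exists u; split => // -[_]; apply.
(* Otherwise the open set [U] minus [B] is nonempty and contains a non-identifiable point, which
   would belong to [B]. *)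
have [||x [y [UBx UBy xy]]] := pairs _ (oD B finB).
- by move=> x /UD /UT.
- by apply: contrapT => /nonemptyPn UB; apply: nUB; apply/subsets_disjoint; rewrite -setDE.
- by apply: UBx.2; apply: nonident UBx UBy xy.
Qed.
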